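(* Let $K$ be a field of characteristic zero and let $\mathcal{O}:=K[x^2]x=\{f(x^2)\,x \mid f\in K[x]\}$ be the set of odd polynomials, which is a monoid $(\mathcal{O},\circ)$ under composition of polynomials with identity element $x$. Then $\mathcal{O}$ is a reduction monoid, where the addition is the usual addition of polynomials and $|\cdot|=\deg$.
   Context: Composition: $(a\circ b)(x):=a(b(x))$. Constants, including the zero polynomial, are assigned $\deg=0$ (so that $\deg$ takes values in $\mathbb{N}$). A multiplicative monoid $\mathcal{M}$ (with group of units $\mathcal{M}^*$) is called a reduction monoid if the following axioms hold for all elements $a,b,c\in\mathcal{M}$. (A1) $\mathcal{M}$ is an abelian group under an addition $+$ such that $(a+b)c=ac+bc$. (A2) There is a map $|\cdot|:\mathcal{M}\to\mathbb{N}=\{0,1,2,\ldots\}$ such that $|ab|=|a||b|$ and $|a+b|\le\max\{|a|,|b|\}$. (A3) $a\in\mathcal{M}^*$ if and only if $|a|=1$. (A4) If $ac=bc$ then $a=b$, provided $|c|>1$. (A5) For any elements $a,b\in\mathcal{M}$ with $|a|>1$ and $|b|>1$ such that there exists an element $x'\in\mathcal{M}a\cap\mathcal{M}b$ with $|x'|\neq 0$, there exists an element $c\in\mathcal{M}$ such that $\mathcal{M}a\cap\mathcal{M}b=\mathcal{M}c$ and $|c|=\mathrm{lcm}(|a|,|b|)$. (A6) If $\alpha a=\beta b$ with $|\alpha|=i$, $|a|=jk$, $|\beta|=j$, $|b|=ik$, $ijk\ge 1$, and the natural numbers $i$ and $j$ are co-prime, then $a=a_1c$ and $b=b_1c$ for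 some elements $a_1,b_1,c\in\mathcal{M}$ such that $|c|=k$. For the monoid $\mathcal{O}$ the product is $\circ$. *)

(* Defs.v *)
From HB Require Import structures.
From mathcomp Require Import all_boot all_order all_fingroup all_algebra.

Set Implicit Arguments.
Unset Strict Implicit.
Unset Printing Implicit Defensive.

Import GRing.Theory.

Section ReductionMonoid.
Local Open Scope group_scope.

Definition is_unit (M : monoidType) (a : M) : Prop :=
  exists b : M, a * b = 1 /\ b * a = 1.

Definition left_multiples (M : monoidType) (a x : M) : Prop :=
  exists u : M, x = u * a.

Definition is_abelian_group (A : Type) (add : A -> A -> A) : Prop :=
  [/\ associative add, commutative add
    & exists (zero : A) (opp : A -> A),
        left_id zero add /\ left_inverse zero opp add].

Record is_reduction_monoid (M : monoidType)
    (add : M -> M -> M) (norm : M -> nat) : Prop := IsReductionMonoid {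
  redmon_addG : is_abelian_group add;
  redmon_mulDl : forall a b c : M, add a b * c = add (a * c) (b * c);
  redmon_normM : forall a b : M, norm (a * b) = (norm a * norm b)%N;
  redmon_normD : forall a b : M, norm (add a b) <= maxn (norm a) (norm b);
  redmon_unit : forall a : M, is_unit a <-> norm a = 1%N;
  redmon_cancel : forall a b c : M, 1 < norm c -> a * c = b * c -> a = b;
  redmon_lcm : forall a b : M, 1 < norm a -> 1 < norm b ->
    (exists x' : M,
       [/\ left_multiples a x', left_multiples b x' & norm x' <> 0%N]) ->
    exists c : M,
      (forall x : M,
         left_multiples a x /\ left_multiples b x <-> left_multiples c x)
      /\ norm c = lcmn (norm a) (norm b);
  redmon_gcd : forall (alpha a beta b : M) (i j k : nat),
    alpha * a = beta * b ->
    norm alpha = i -> norm a = (j * k)%N ->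
    norm beta = j -> norm b = (i * k)%N ->
    0 < i * j * k -> coprime i j ->
    exists a1 b1 c : M, [/\ a = a1 * c, b = b1 * c & norm c = k]
}.

End ReductionMonoid.

Section OddPolynomials.
Local Open Scope ring_scope.
Variable K : fieldType.

(* The only possible f with p = f(x^2) x is f = odd_poly p, which makes
   membership in K[x^2]x decidable; see odd_polynomialP. *)
Definition odd_polynomial : {pred {poly K}} :=
  [pred p | p == (odd_poly p \Po 'X^2) * 'X].

Lemma odd_polynomialP (p : {poly K}) :
  reflect (exists f : {poly K}, p = (f \Po 'X^2) * 'X) (p \in odd_polynomial).
Proof.
apply: (iffP eqP) => [pE | [f ->]]; first by exists (odd_poly p).
congr (_ * _); rewrite odd_polyMX; congr (_ \Po _).
apply/polyP => i.
by rewrite coef_even_poly coef_comp_poly_Xn // dvdn2 odd_double divn2 doubleK.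
Qed.

Fact odd_polynomial_zmod_closed : zmod_closed odd_polynomial.
Proof.
split=> [|_ _ /odd_polynomialP[f ->] /odd_polynomialP[g ->]].
  by apply/odd_polynomialP; exists 0; rewrite linear0 mul0r.
by apply/odd_polynomialP; exists (f - g); rewrite linearB mulrBl.
Qed.

HB.instance Definition _ :=
  GRing.isZmodClosed.Build {poly K} odd_polynomial odd_polynomial_zmod_closed.

Record oddPoly := OddPoly {
  oddPoly_val :> {poly K};
  oddPoly_valP : oddPoly_val \in odd_polynomial
}.

HB.instance Definition _ := [isSub for oddPoly_val].
HB.instance Definition _ := [Choice of oddPoly by <:].
HB.instance Definition _ := [SubChoice_isSubZmodule of oddPoly by <:].

Fact odd_polynomialX : 'X \in odd_polynomial.
Proof. by apply/odd_polynomialP; exists 1; rewrite comp_polyC mul1r. Qed.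

Fact odd_polynomial_comp (p q : {poly K}) :
  p \in odd_polynomial -> q \in odd_polynomial -> p \Po q \in odd_polynomial.
Proof.
move=> /odd_polynomialP[f ->] /odd_polynomialP[g ->]; apply/odd_polynomialP.
exists ((f \Po (g ^+ 2 * 'X)) * g).
rewrite !(comp_polyM, comp_polyX) -!comp_polyA mulrA !comp_Xn_poly.
by rewrite !(comp_polyM, comp_polyX) exprMn.
Qed.

Definition oddPoly_id : oddPoly := OddPoly odd_polynomialX.

Definition oddPoly_comp (p q : oddPoly) : oddPoly :=
  OddPoly (odd_polynomial_comp (oddPoly_valP p) (oddPoly_valP q)).

Fact oddPoly_compA : associative oddPoly_comp.
Proof. by move=> p q r; apply: val_inj; rewrite /= comp_polyA. Qed.

Fact oddPoly_comp1p : left_id oddPoly_id oddPoly_comp.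
Proof. by move=> p; apply: val_inj; rewrite /= comp_polyX. Qed.

Fact oddPoly_compp1 : right_id oddPoly_id oddPoly_comp.
Proof. by move=> p; apply: val_inj; rewrite /= comp_polyXr. Qed.

HB.instance Definition _ :=
  isMonoid.Build oddPoly oddPoly_compA oddPoly_comp1p oddPoly_compp1.

(* As size 0 = 0, the truncated predecessor gives degree 0 to the zero
   polynomial too. *)
Definition deg (p : {poly K}) : nat := (size p).-1.

End OddPolynomials.

(* Main.v *)
Require Import Defs.
From mathcomp Require Import all_boot all_order all_fingroup all_algebra.
From mathcomp Require Import zify ring.

Set Implicit Arguments.
Unset Strict Implicit.
Unset Printing Implicit Defensive.

Import GRing.Theory.
Local Open Scope ring_scope.

(** The axioms A1 to A4 only express that composition is additive on the left,
that degrees multiply under composition, that an odd polynomial of degree 1 is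
a nonzero multiple of [X], and that composing on the right with a nonconstant
polynomial is injective.  The content is in A5 and A6, which are the polynomial
forms of the theorems of Engstrom and of Lüroth.

Both end with the same descent, [odd_descent].  Suppose a family of polynomials
is stable under subtraction of scalar multiples of powers of an odd polynomial
[c], and has all its degrees divisible by [deg c].  Then leading terms can be
cancelled one after the other, so every odd member of the family is [q(c)] for
some [q]; only odd powers of [c] are used, since odd polynomials have odd
degree, and therefore [q] is odd.

A5.  Let [F = u(a) = v(b)] have degree [l * M], where [l] is the least common
multiple of [deg a] and [deg b].  In characteristic 0 there is a unique monic
approximate [M]-th root [q] of [F]: it satisfies
[deg (F - lc(F) q^M) < deg F - deg q] ([approx_root_exists],
[approx_root_uniq]).  Composition preserves approximate roots
([approx_root_comp]), so composing those of [u] and [v] with [a] and [b]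
produces two approximate roots of [F], up to scaling, and they are equal by
uniqueness.  This gives an odd common composite of degree [l]
([odd_common_composite]); any other one is a polynomial in it by the descent,
because degrees of common composites are divisible by [l].

A6.  Let [alpha(a) = beta(b)] with [deg a = j k], [deg b = i k], [deg beta = j]
and [i], [j] coprime.  Put [R = K[a, b]].
 - [R] is spanned over [K] by the [a^u b^v] with [v < j], and these have
   pairwise distinct degrees, all divisible by [k].  So [k] divides the degree
   of every element of [R] ([pair_eval_dvd]).
 - Counting dimensions yields a nontrivial relation
   [P(x, y) = r_0(x) + r_1(x) y + ... + r_k(x) y^k] with [r_s] in [R] and
   [P(x, x) = 0] ([exists_dependence]).  The degrees of the terms [r_s(x) x^s]
   are distinct modulo [k] apart from those of [s = 0] and [s = k]; since the
   leading terms must cancel, [deg r_0 = deg r_k + k], and there is no such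
   relation of smaller degree in [y] ([dependence_tie]).
 - Pseudo-division of [a(y) - a(x)] by [P] over [R] leaves a remainder which is
   again such a relation, hence is zero.  As [a(y) - a(x)] has a constant
   leading coefficient in [y], the lemma of Gauss ([lead_coef_dvd]) makes [r_k]
   divide every [r_s], and [q = r_0 / r_k] is a polynomial of degree exactly [k]
   in the fraction field of [R] ([exists_deg_quotient]).
 - The polynomials lying in the fraction field of [R] have degrees divisible by
   [k], and they are stable under [p(x) |-> p(-x)] as [a] and [b] are odd.
   Therefore [c = q(x) - q(-x)] is odd of degree [k], and the descent writes
   [a] and [b] as odd polynomials in [c] ([odd_right_factor]). *)

(** * Degrees *)

Section Degree.
Variable K : fieldType.
Implicit Types p q c : {poly K}.

Lemma size_deg p : p != 0 -> size p = (deg p).+1.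
Proof. by move=> p0; rewrite /deg prednK // size_poly_gt0. Qed.

Lemma deg_gt0 p : (0 < deg p)%N = (1 < size p)%N.
Proof. by rewrite /deg; case: (size p) => [|[]]. Qed.

Lemma deg_gt0_neq0 p : (0 < deg p)%N -> p != 0.
Proof. by apply: contraTneq => ->; rewrite /deg size_poly0. Qed.

Lemma deg_comp p q : deg (p \Po q) = (deg p * deg q)%N.
Proof. exact: size_comp_poly. Qed.

Lemma degM p q : p != 0 -> q != 0 -> deg (p * q) = (deg p + deg q)%N.
Proof. by move=> p0 q0; rewrite /deg size_mul // !size_deg // addnS. Qed.

Lemma degX p n : deg (p ^+ n) = (deg p * n)%N.
Proof. exact: size_exp. Qed.

Lemma degXn n : deg ('X^n : {poly K}) = n.
Proof. by rewrite /deg size_polyXn. Qed.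

Lemma degZ (x : K) p : x != 0 -> deg (x *: p) = deg p.
Proof. by move=> x0; rewrite /deg size_scale. Qed.

Lemma size_le_coef (R : nzRingType) (p : {poly R}) n :
  (size p <= n.+1)%N -> p`_n = 0 -> (size p <= n)%N.
Proof.
move=> /leq_sizeP szp pn; apply/leq_sizeP => j; rewrite leq_eqVlt.
by case/predU1P=> [<- // | /szp].
Qed.

Lemma size_cancel_lead p q : p != 0 -> q != 0 -> deg p = deg q ->
  (size (p - (lead_coef p / lead_coef q) *: q)%R < size p)%N.
Proof.
move=> p0 q0 dpq; rewrite [X in (_ < X)%N]size_deg // ltnS.
apply: size_le_coef.
  apply: leq_trans (size_polyD _ _) _; rewrite geq_max size_deg // leqnn /=.
  by rewrite size_polyN dpq -size_deg // size_scale_leq.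
rewrite coefB coefZ {2}dpq -!lead_coefE mulfVK ?subrr //.
by rewrite lead_coef_eq0.
Qed.

End Degree.

(** * Odd polynomials *)

Section OddClosure.
Variable K : fieldType.
Implicit Types p : {poly K}.

Lemma odd_polynomialZ (x : K) p :
  p \in @odd_polynomial K -> x *: p \in @odd_polynomial K.
Proof.
move=> /odd_polynomialP[f ->]; apply/odd_polynomialP; exists (x *: f).
by rewrite comp_polyZ scalerAl.
Qed.

Lemma odd_polynomial_exp p n :
  odd n -> p \in @odd_polynomial K -> p ^+ n \in @odd_polynomial K.
Proof.
move=> on op; rewrite -comp_Xn_poly; apply: odd_polynomial_comp => //.
apply/odd_polynomialP; exists 'X^(n./2).
by rewrite comp_Xn_poly -exprM -exprSr mul2n -[in LHS](odd_double_half n) on.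
Qed.

Lemma odd_deg p : p \in @odd_polynomial K -> p != 0 -> odd (deg p).
Proof.
case/odd_polynomialP=> f -> p0.
have : lead_coef ((f \Po 'X^2) * 'X) != 0 by rewrite lead_coef_eq0.
rewrite lead_coefE -/(deg _).
case: (deg _) => [|n]; first by rewrite coefMX /= eqxx.
by rewrite coefMX coef_comp_poly_Xn // dvdn2 /=; case: (odd n); rewrite ?eqxx.
Qed.

(** Cancelling the leading term of [p] with a multiple of [c^m] is possible as
[deg c] divides [deg p]; the exponent [m] is odd because [deg p] is, which is
what keeps the outer polynomial odd. *)
Lemma odd_descent (T : {poly K} -> Prop) (c : {poly K}) :
    c \in @odd_polynomial K -> (0 < deg c)%N ->
    (forall p, T p -> (deg c %| deg p)%N) ->
    (forall p (x : K) m, T p -> T (p - x *: c ^+ m)) ->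
  forall p, p \in @odd_polynomial K -> T p ->
  exists2 q, q \in @odd_polynomial K & p = q \Po c.
Proof.
move=> oc c_gt0 Tdvd Tsub p; have [n] := ubnP (size p).
elim: n p => // n IHn p /ltnSE szp op Tp.
have [-> | p0] := eqVneq p 0; first by exists 0; rewrite ?rpred0 ?comp_poly0.
have /dvdnP[m dp] := Tdvd p Tp.
have om : odd m by move: (odd_deg op p0); rewrite dp oddM => /andP[].
have c0 := deg_gt0_neq0 c_gt0.
set x := lead_coef p / lead_coef (c ^+ m).
have [||| q oq pE] := IHn (p - x *: c ^+ m); last 1 first.
- exists (q + x *: 'X^m).
    by rewrite rpredD ?odd_polynomialZ ?odd_polynomial_exp ?odd_polynomialX.
  by rewrite comp_polyD comp_polyZ comp_Xn_poly -pE subrK.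
- apply: leq_trans szp; apply: size_cancel_lead; rewrite ?expf_neq0 //.
  by rewrite degX dp mulnC.
- by rewrite rpredB ?odd_polynomialZ ?odd_polynomial_exp.
- exact: Tsub.
Qed.

End OddClosure.

Section OddReflection.
Variable K : fieldType.
Hypothesis two : 2%:R != 0 :> K.
Implicit Types p : {poly K}.

Lemma odd_polynomial_reflect p :
  (p \in @odd_polynomial K) = (p \Po (- 'X) == - p).
Proof.
have sub (f : {poly K}) : (f \Po 'X^2) \Po (- 'X) = f \Po 'X^2.
  by rewrite -comp_polyA comp_Xn_poly sqrrN.
apply/odd_polynomialP/eqP => [[f ->]|].
  by rewrite comp_polyM sub comp_polyX mulrN.
have pE := poly_even_odd p; move: pE; set E := even_poly p \Po 'X^2.
set O := _ * 'X => pE pN; exists (odd_poly p); rewrite -/O.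
have : (E + O) \Po (- 'X) = E - O.
  have -> : - O = O \Po (- 'X) by rewrite comp_polyM sub comp_polyX mulrN.
  by rewrite comp_polyD [E \Po _]sub.
rewrite pE pN -{1}pE opprD => /addIr/eqP; rewrite eq_sym -addr_eq0 -mulr2n.
by rewrite -scaler_nat scaler_eq0 (negPf two) => /eqP E0; rewrite -pE E0 add0r.
Qed.

Lemma odd_polynomialN_comp p : p \in @odd_polynomial K -> p \Po (- 'X) = - p.
Proof. by rewrite odd_polynomial_reflect => /eqP. Qed.

End OddReflection.

(** * Approximate roots and common composites *)

Section ApproximateRoot.
Variable K : fieldType.
Hypothesis char0 : [pchar K] =i pred0.
Implicit Types f u a p q : {poly K}.

(** Abhyankar's approximate [M]-th roots.  Since the size of a nonzero
polynomial is its degree plus one, the last clause is the strict inequality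
[deg (f - lc(f) q^M) < deg f - deg q], with no exception when [f] equals
[lc(f) q^M]. *)
Definition approx_root M f q :=
  [/\ q \is monic, (deg q * M)%N = deg f
    & (size (f - lead_coef f *: q ^+ M)%R + deg q <= deg f)%N].

(** The cofactor of [p - q] in [p^M - q^M] has all its [M] terms monic of the
same degree.  Its leading coefficient is thus [M], which is where the
characteristic enters. *)
Lemma size_coef_power_sum (p q : {poly K}) M :
    p \is monic -> q \is monic -> deg p = deg q -> (0 < M)%N ->
  let s := \sum_(i < M) p ^+ (M.-1 - i) * q ^+ i in
  (size s <= (deg q * M.-1).+1)%N /\ s`_(deg q * M.-1) = M%:R.
Proof.
move=> mp mq dpq M0 s.
have term (i : 'I_M) : let t := p ^+ (M.-1 - i) * q ^+ i in
    t \is monic /\ deg t = (deg q * M.-1)%N.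
  split; first by rewrite rpredM ?monic_exp.
  rewrite degM ?monic_neq0 ?monic_exp // !degX dpq -mulnDr subnK //.
  by rewrite -ltnS prednK // ltn_ord.
split.
  apply: leq_trans (size_sum _ _ _) _; apply/bigmax_leqP => i _.
  by have [mt <-] := term i; rewrite size_deg ?monic_neq0.
rewrite coef_sum -[in RHS](card_ord M) -sumr_const; apply: eq_bigr => i _.
by have [/monicP mt <-] := term i; rewrite -lead_coefE.
Qed.

Lemma natr_neq0 n : (0 < n)%N -> n%:R != 0 :> K.
Proof. by move=> n0; rewrite (proj1 (pcharf0P K) char0) -lt0n. Qed.

(** Two approximate roots [p] and [q] satisfy
[deg (p^M - q^M) < deg f - deg q = deg q * M.-1], and this is the degree of the
cofactor of [p - q] in [p^M - q^M]; so [p - q] is zero. *)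
Lemma approx_root_uniq M f p q : (0 < M)%N -> f != 0 ->
  approx_root M f p -> approx_root M f q -> p = q.
Proof.
move=> M0 f0 [mp dp sp] [mq dq sq].
have dpq : deg p = deg q by apply/eqP; rewrite -(eqn_pmul2r M0) dp dq.
have [szs cs] := size_coef_power_sum mp mq dpq M0.
set s := \sum_(i < M) _ in szs cs.
have s0 : s != 0.
  by apply: contraTneq (natr_neq0 M0) => s0; rewrite -cs s0 coef0 eqxx.
have ds : deg s = (deg q * M.-1)%N.
  apply/eqP; rewrite eqn_leq -ltnS -size_deg // szs /=.
  rewrite -ltnS -size_deg // ltnNge; apply/negP => /leq_sizeP/(_ _ (leqnn _)).
  by rewrite cs => /eqP; rewrite (negPf (natr_neq0 M0)).
apply/eqP; rewrite -subr_eq0; apply/negP => /negP d0.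
have : (size ((lead_coef f) *: (p ^+ M - q ^+ M))%R <= deg f - deg q)%N.
  have -> : lead_coef f *: (p ^+ M - q ^+ M) =
     (f - lead_coef f *: q ^+ M) - (f - lead_coef f *: p ^+ M).
    by rewrite scalerBr; ring.
  apply: leq_trans (size_polyD _ _) _; rewrite size_polyN geq_max.
  move: sp sq; rewrite dpq; move: (size _) (size _) (deg f) (deg q) => A B C D.
  lia.
rewrite size_scale ?lead_coef_eq0 // subrXX -/s size_mul // !size_deg // ds.
by rewrite -dq; move: M0; case: (M) => // M' _ /=; lia.
Qed.

(** The coefficients of [q] are determined from the top: adding a term
[x X^(d - e.+1)] to [q] changes [q^M] first in degree [deg f - e.+1], by
[M x]. *)
Lemma approx_root_exists M f d : (0 < M)%N -> f != 0 -> (d * M)%N = deg f ->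
  exists q, approx_root M f q.
Proof.
move=> M0 f0 df; set l := lead_coef f.
have l0 : l != 0 by rewrite lead_coef_eq0.
suff /(_ d (leqnn d)) [q [mq dq sq]] : forall e, (e <= d)%N -> exists q,
    [/\ q \is monic, deg q = d & (size (f - l *: q ^+ M)%R + e <= deg f)%N].
  by exists q; split=> //; rewrite dq.
elim=> [|e IHe] led.
  exists 'X^d; rewrite monicXn degXn; split=> //.
  rewrite addn0 -ltnS -size_deg // -exprM df.
  have := @size_cancel_lead _ f 'X^(deg f) f0 (monic_neq0 (monicXn _ _)).
  by rewrite degXn (monicP (monicXn _ _)) divr1; apply.
have [q [mq dq sq]] := IHe (ltnW led).
set n := (deg f - e.+1)%N; set D := f - l *: q ^+ M in sq.
have led' : (e.+1 <= deg f)%N by rewrite -df (leq_trans led) // leq_pmulr.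
have szD : (size D <= n.+1)%N by rewrite /n; lia.
set x := D`_n / (l * M%:R).
set t := x *: 'X^(d - e.+1).
have szt : (size t <= d)%N.
  apply: leq_trans (size_scale_leq _ _) _; rewrite size_polyXn; lia.
have szq : size q = d.+1 by rewrite size_deg ?monic_neq0 // dq.
have szqt : (size t < size q)%N by rewrite szq ltnS.
have mq' : q + t \is monic by rewrite monicE lead_coefDl // -monicE.
have dq' : deg (q + t) = d by rewrite /deg size_polyDl // szq.
exists (q + t); split=> //.
suff: (size (f - l *: (q + t) ^+ M)%R <= n)%N by rewrite /n; lia.
have [szs cs] := size_coef_power_sum mq' mq (etrans dq' (esym dq)) M0.
set s := \sum_(i < M) _ in szs cs.
have DE : f - l *: (q + t) ^+ M = D - (l * x) *: (s * 'X^(d - e.+1)).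
  have -> : (l * x) *: (s * 'X^(d - e.+1)) = l *: ((q + t) ^+ M - q ^+ M).
    by rewrite subrXX -/s addrC addKr -scalerA -scalerAl mulrC.
  by rewrite /D scalerBr; ring.
have nE : n = (deg q * M.-1 + (d - e.+1))%N.
  by rewrite /n -df dq; move: M0; case: (M) => // M' _; rewrite mulnS /=; lia.
rewrite DE; apply: size_le_coef.
  apply: leq_trans (size_polyD _ _) _; rewrite size_polyN geq_max szD /=.
  apply: leq_trans (size_scale_leq _ _) _.
  apply: leq_trans (size_polyMleq _ _) _.
  by rewrite size_polyXn addnS /= nE -addSn leq_add2r.
rewrite coefB coefZ coefMXn nE ltnNge leq_addl /= addnK cs.
by rewrite -nE mulrAC mulrC divfK ?subrr // mulf_neq0 ?natr_neq0.
Qed.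

(** The error term of [u] has degree less than [deg u - deg q], and composing
with [a] multiplies all these degrees by [deg a]. *)
Lemma approx_root_comp M u a q : (0 < deg a)%N -> u != 0 ->
  approx_root M u q ->
  approx_root M (u \Po a) (lead_coef a ^- deg q *: (q \Po a)).
Proof.
move=> a_gt0 u0 [mq dq sq]; set m := lead_coef a ^+ deg q.
have sza : (1 < size a)%N by rewrite -deg_gt0.
have m0 : m != 0 by rewrite expf_neq0 // lead_coef_eq0 deg_gt0_neq0.
have lq : lead_coef (q \Po a) = m by rewrite lead_coef_comp // (monicP mq) mul1r.
have dQ : deg (m^-1 *: (q \Po a)) = (deg q * deg a)%N.
  by rewrite degZ ?invr_neq0 // deg_comp.
split.
- by rewrite monicE lead_coefZ lq mulVf.
- by rewrite dQ deg_comp -dq mulnAC.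
have -> : lead_coef (u \Po a) *: (m^-1 *: (q \Po a)) ^+ M
          = (lead_coef u *: q ^+ M) \Po a.
  rewrite lead_coef_comp // -/(deg u) -dq exprM -/m exprZn scalerA -mulrA.
  by rewrite exprVn (divff (expf_neq0 M m0)) mulr1 comp_polyZ rmorphXn.
rewrite -comp_polyB dQ deg_comp; set r := u - _ in sq *.
have [-> | r0] := eqVneq r 0.
  by rewrite comp_poly0 size_poly0 leq_mul2r -dq; move: sq; rewrite -dq; lia.
rewrite size_deg ?comp_poly_eq0 // deg_comp.
have {}sq : ((deg r).+1 + deg q <= deg u)%N by rewrite -size_deg.
by apply: leq_trans (leq_mul sq (leqnn _)); rewrite mulnDl mulSn; lia.
Qed.

(** The map [q(x) |-> -q(-x)] permutes the approximate roots of an odd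
polynomial, and there is only one. *)
Lemma approx_root_odd M u q : (0 < M)%N -> u != 0 ->
  u \in @odd_polynomial K -> approx_root M u q -> q \in @odd_polynomial K.
Proof.
move=> M0 u0 ou qP; have [mq dq _] := qP.
have two : 2%:R != 0 :> K := @natr_neq0 2 isT.
have := odd_deg ou u0; rewrite -dq oddM => /andP[odq oM].
have dNX : deg (- 'X : {poly K}) = 1%N by rewrite /deg size_polyN size_polyX.
have := approx_root_comp (a := - 'X) _ u0 qP; rewrite dNX lead_coefN lead_coefX.
rewrite odd_polynomialN_comp // => /(_ isT) [mQ dQ sQ].
have {}mQ : approx_root M u (- (q \Po (- 'X))).
  suff <- : (- 1) ^- deg q *: (q \Po - 'X) = - (q \Po (- 'X)).
    split=> //; first by rewrite dQ /deg size_polyN.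
    move: sQ; rewrite lead_coefN scaleNr -opprD size_polyN => sQ.
    by apply: leq_trans sQ _; rewrite /deg size_polyN.
  by rewrite -signr_odd odq expr1 invrN1 scaleN1r.
rewrite odd_polynomial_reflect //.
by rewrite {2}(approx_root_uniq M0 u0 qP mQ) opprK.
Qed.

(** With [M = deg (u(a)) / lcm (deg a) (deg b)], the approximate [M]-th roots of
[u] and of [v], composed with [a] and [b] and made monic, are both the
approximate [M]-th root of [u(a) = v(b)]. *)
Lemma odd_common_composite a b u v :
    u \in @odd_polynomial K -> v \in @odd_polynomial K ->
    (0 < deg a)%N -> (0 < deg b)%N -> u != 0 -> u \Po a = v \Po b ->
  exists alpha beta, [/\ alpha \in @odd_polynomial K,
    beta \in @odd_polynomial K, alpha \Po a = beta \Po b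
    & deg (alpha \Po a) = lcmn (deg a) (deg b)].
Proof.
have two : 2%:R != 0 :> K := @natr_neq0 2 isT.
move=> ou ov a0 b0 u0 uv.
have dF : (lcmn (deg a) (deg b) %| deg (u \Po a))%N.
  by rewrite dvdn_lcm {2}uv !deg_comp !dvdn_mull.
have [M dM] := dvdnP dF.
have F0 : u \Po a != 0 by rewrite comp_poly_eq0 // -deg_gt0.
have v0 : v != 0 by apply: contraNneq F0 => v0; rewrite uv v0 comp_poly0.
have ua_gt0 : (0 < deg (u \Po a))%N.
  by rewrite deg_comp muln_gt0 a0 odd_gt0 // odd_deg.
have M0 : (0 < M)%N by move: ua_gt0; rewrite dM; case: (M).
have root w c : w \in @odd_polynomial K -> w != 0 -> (0 < deg c)%N ->
    w \Po c = u \Po a -> (deg c %| lcmn (deg a) (deg b))%N ->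
  exists2 q, q \in @odd_polynomial K & approx_root M (u \Po a) (q \Po c).
  move=> ow w0 c0 wc /dvdnP[d dl].
  have dw : (d * M)%N = deg w.
    apply/eqP; rewrite -(eqn_pmul2r c0) -deg_comp wc dM dl; apply/eqP; ring.
  have [q qP] := approx_root_exists M0 w0 dw.
  exists (lead_coef c ^- deg q *: q).
    by rewrite odd_polynomialZ // (approx_root_odd M0 w0 ow qP).
  by rewrite comp_polyZ -wc; apply: approx_root_comp.
have [alpha oalpha Pa] := root u a ou u0 a0 erefl (dvdn_lcml _ _).
have [beta obeta Pb] := root v b ov v0 b0 (esym uv) (dvdn_lcmr _ _).
exists alpha, beta; split=> //; first exact: approx_root_uniq Pa Pb.
have [_ dq _] := Pa; apply/eqP; rewrite -(eqn_pmul2r M0) dq dM.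
by rewrite mulnC.
Qed.

End ApproximateRoot.

(** The common composites of [a] and [b] form a ring whose degrees are multiples
of [lcm (deg a) (deg b)], so the descent applies to them. *)
Lemma odd_common_composite_factor (K : fieldType)
    (a b alpha beta u v : {poly K}) :
    alpha \Po a \in @odd_polynomial K -> u \Po a \in @odd_polynomial K ->
    (0 < deg a)%N -> (0 < deg b)%N ->
    alpha \Po a = beta \Po b -> u \Po a = v \Po b ->
    deg (alpha \Po a) = lcmn (deg a) (deg b) ->
  exists2 w, w \in @odd_polynomial K & u \Po a = w \Po (alpha \Po a).
Proof.
move=> oC oy a_gt0 b_gt0 CE yE dC.
pose T p := (exists u, p = u \Po a) /\ (exists v, p = v \Po b).
apply: (@odd_descent _ T) => // [|p|p z m|].
- by rewrite dC lcmn_gt0 a_gt0.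
- by move=> [[u1 ->] [v1 E]]; rewrite dC dvdn_lcm {2}E !deg_comp !dvdn_mull.
- have pow (q c d : {poly K}) : (d - z *: q ^+ m) \Po c =
      (d \Po c) - z *: (q \Po c) ^+ m.
    by rewrite comp_polyB comp_polyZ rmorphXn.
  move=> [[u1 pu] [v1 pv]]; split.
    by exists (u1 - z *: alpha ^+ m); rewrite pow -pu.
  by exists (v1 - z *: beta ^+ m); rewrite pow -pv -CE.
- by split; [exists u | exists v].
Qed.

(** * Sums of polynomials with distinct degrees *)

Section DistinctDegrees.
Variable K : fieldType.

(** A term of maximal degree survives in the sum, unless another term ties with
it. *)
Lemma deg_sum_tie (I : finType) (f : I -> {poly K}) :
    (exists x, f x != 0) ->
  (exists x y, [/\ x != y, f x != 0, f y != 0 & deg (f x) = deg (f y)]) \/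
  (exists2 x, f x != 0 & size (\sum_y f y) = size (f x)).
Proof.
move=> [x0 fx0]; have [x _ xmax] := @arg_maxnP _ x0 predT (size \o f) isT.
have fx : f x != 0.
  by rewrite -size_poly_gt0 (leq_trans _ (xmax x0 isT)) //= size_poly_gt0.
have [/existsP[y /and3P[yx fy /eqP dyx]] | /existsPn untied] :=
  boolP [exists y, [&& y != x, f y != 0 & deg (f y) == deg (f x)]].
  by left; exists y, x.
right; exists x => //; rewrite (bigD1 x) //= size_polyDl //.
apply: leq_ltn_trans (size_sum _ _ _) _; rewrite [size (f x)]size_deg // ltnS.
apply/bigmax_leqP => y yx.
have [-> | fy] := eqVneq (f y) 0; first by rewrite size_poly0.
have := xmax y isT; rewrite /= !size_deg // ltnS leq_eqVlt.
by move: (untied y); rewrite yx fy /= => /negPf->.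
Qed.

Lemma poly_family_dependent (I : finType) (f : I -> {poly K}) n :
    (forall x, size (f x) <= n)%N -> (n < #|I|)%N ->
  exists2 c : I -> K, exists x, c x != 0 & \sum_x c x *: f x = 0.
Proof.
move=> szf nI; pose A := \matrix_(r < #|I|, s < n) (f (enum_val r))`_s.
have : kermx A != 0.
  rewrite kermx_eq0 /row_free neq_ltn (leq_ltn_trans (rank_leq_col _)) //.
case/rowV0Pn=> v /sub_kermxP vA /rV0Pn [r vr].
exists (fun x => v 0 (enum_rank x)).
  by exists (enum_val r); rewrite enum_valK.
apply/polyP=> s; rewrite coef0 coef_sum.
have [sn | ns] := ltnP s n; last first.
  by apply: big1 => x _; rewrite coefZ nth_default ?mulr0 // (leq_trans (szf x)).
have := congr1 (fun w : 'rV_n => w 0 (Ordinal sn)) vA.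
rewrite !mxE; apply: etrans.
rewrite (reindex (@enum_val I predT)) /=; last exact/onW_bij/enum_val_bij.
by apply: eq_bigr => q _; rewrite coefZ mxE enum_valK.
Qed.

End DistinctDegrees.

(** * The lemma of Gauss over [K[x]] *)

Section Gauss.
Variable K : fieldType.
Implicit Types P H A : {poly {poly K}}.

(** The coefficients of [P] have greatest common divisor 1, in the form of a
cancellation property that requires neither irreducible factors nor Bezout
coefficients. *)
Definition primitive P := forall d e : {poly K},
  (forall n, d %| P`_n * e) -> d %| e.

(** The content [g] is accumulated along the list of coefficients; as products
distribute over greatest common divisors, a common divisor of all [P_n e] also
divides [g e]. *)
Lemma content_decomposition P :
  exists (g : {poly K}) P', P = g *: P' /\ (P != 0 -> primitive P').
Proof.
have [g gP gE] : exists2 g : {poly K}, forall p, p \in (P : seq _) -> g %| p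
    & forall d e, (forall p, p \in (P : seq _) -> d %| p * e) -> d %| g * e.
  elim: (P : seq _) => [|p s [g gs gE]].
    by exists 0 => // d e _; rewrite mul0r dvdp0.
  exists (gcdp p g) => [q|d e dps].
    rewrite inE => /predU1P[-> | /gs]; first exact: dvdp_gcdl.
    exact/dvdp_trans/dvdp_gcdr.
  rewrite (eqp_dvdr _ (mulp_gcdl _ _ _)) dvdp_gcd dps ?mem_head //.
  by apply: gE => q qs; apply: dps; rewrite inE qs orbT.
have gPn n : g %| P`_n.
  by have [/gP // | nP] := boolP (P`_n \in (P : seq _));
     rewrite nth_default ?dvdp0 // leqNgt; apply: contra nP => /mem_nth->.
exists g, (\poly_(n < size P) (P`_n %/ g)); split=> [|P0 d e dP].
  apply/polyP=> n; rewrite coefZ coef_poly.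
  by case: ltnP => [_|/(nth_default _)->]; rewrite ?mulr0 // mulrC divpK.
have g0 : g != 0.
  apply: contraNneq P0 => g0; apply/eqP/polyP => n; rewrite coef0.
  by have := gPn n; rewrite g0 dvd0p => /eqP.
rewrite -(dvdp_mul2l _ _ g0); apply: gE => p /(nthP 0)[n nP <-].
have := dP n; rewrite coef_poly nP -(dvdp_mul2l _ _ g0) mulrA.
by rewrite [g * (_ %/ _)]mulrC divpK.
Qed.

(** McCoy's argument.  Suppose that [d] divides [P_m H] for all [m > l], and let
[h] be the degree of [H].  The coefficient of [P H] of index [l + h] is then
[P_l H_h] modulo [d].  So [P_l H] agrees modulo [d] with [P_l] times the
truncation of [H] below degree [h]; that polynomial is shorter than [H], and
its product with [P] is again divisible by [d]. *)
Lemma primitive_dvd P H d : primitive P ->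
  (forall n, d %| (P * H)`_n) -> forall n, d %| H`_n.
Proof.
move=> prim; have [m] := ubnP (size H); elim: m H => // m IHm H szH dPH.
have [-> n | H0] := eqVneq H 0; first by rewrite coef0 dvdp0.
suff coefs : forall l n, d %| P`_l * H`_n by move=> n; apply: prim.
move=> l; have [u] := ubnP (size P - l); elim: u l => // u IHu l szl.
have dvd_gt l' n : (l < l')%N -> d %| P`_l' * H`_n.
  move=> ll'; have [Pl' | l'P] := leqP (size P) l'.
    by rewrite nth_default // mul0r dvdp0.
  by apply: IHu; lia.
pose h := (size H).-1.
have dvd_lead : d %| P`_l * H`_h.
  have := dPH (l + h)%N; rewrite coefM.
  have lt_l : (l < (l + h).+1)%N by rewrite ltnS leq_addr.
  rewrite (bigD1 (Ordinal lt_l)) //= addKn dvdp_addl //.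
  apply: (big_ind (fun x => d %| x)) => [|x y dx dy|w wl]; first exact: dvdp0.
    by rewrite dvdp_add.
  have [lw|wl'] := ltnP l w; first exact: dvd_gt.
  have {}wl : (w < l)%N by rewrite ltn_neqAle wl' andbT.
  rewrite [H`__]nth_default ?mulr0 ?dvdp0 //.
  have : (0 < size H)%N by rewrite size_poly_gt0.
  rewrite /h; move: (size H) (nat_of_ord w) wl; lia.
pose H' := P`_l *: (H - H`_h *: 'X^h).
have dH' n : d %| P`_l * H`_n - H'`_n.
  rewrite coefZ -mulrBr coefB opprB addrC subrK coefZ coefXn mulrA.
  exact: dvdp_mulr.
suff dH'n n : d %| H'`_n by move=> n; rewrite -[_ * _](subrK H'`_n) dvdp_add.
apply: IHm => {n}[|n].
  have szHh : size H = h.+1 by rewrite /h prednK // size_poly_gt0.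
  apply: leq_ltn_trans (size_scale_leq _ _) _.
  apply: leq_ltn_trans (_ : (h < m)%N); last by rewrite -ltnS -szHh.
  apply: size_le_coef; last by rewrite coefB coefZ coefXn eqxx mulr1 subrr.
  apply: leq_trans (size_polyD _ _) _; rewrite size_polyN geq_max szHh leqnn /=.
  by apply: leq_trans (size_scale_leq _ _) _; rewrite size_polyXn.
have -> : (P * H')`_n = P`_l * (P * H)`_n - (P`_l * H`_h) * (P * 'X^h)`_n.
  by rewrite /H' -scalerAr mulrBr -scalerAr coefZ coefB coefZ; ring.
by apply: dvdp_sub; [apply: dvdp_mull | apply: dvdp_mulr].
Qed.

(** Write [P = g P'] with [P'] primitive.  Then [c] divides [g H], whence [P']
divides [A] and its leading coefficient divides a nonzero constant.  The leading
coefficient of [P] is therefore the content [g] up to a unit. *)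
Lemma lead_coef_dvd P H A (c : {poly K}) : c != 0 ->
    size (lead_coef A) = 1%N -> c *: A = P * H ->
  forall n, lead_coef P %| P`_n.
Proof.
move=> c0; set lam := lead_coef A => lam1 cA n; have [g [P' [PE prim]]] := content_decomposition P.
have lam0 : lam != 0 by rewrite -size_poly_eq0 lam1.
have P0 : P != 0.
  apply: contraTneq lam0 => P0; rewrite lead_coef_eq0 negbK.
  by move/eqP: cA; rewrite P0 mul0r -mul_polyC mulf_eq0 polyC_eq0 (negPf c0).
have dvd_c m : c %| (g *: H)`_m.
  apply: (primitive_dvd (prim P0)) => q.
  by rewrite -scalerAr scalerAl -PE -cA coefZ dvdp_mulr.
pose H' := \poly_(m < size (g *: H)) ((g *: H)`_m %/ c).
have gH : g *: H = c *: H'.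
  apply/polyP=> m; rewrite [in RHS]coefZ coef_poly.
  by case: ltnP => [_|/(nth_default _)->]; rewrite ?mulr0 // mulrC divpK.
have AE : A = P' * H'.
  have cP0 : c%:P != 0 by rewrite polyC_eq0.
  by apply: (mulfI cP0); rewrite !mul_polyC cA PE -scalerAl scalerAr gH scalerAr.
have : lead_coef P' %| lam by rewrite /lam AE lead_coefM dvdp_mulr.
rewrite PE lead_coefZ coefZ => lP'.
apply: dvdp_mul => //; apply: dvdp_trans lP' _.
have /eqp_dvdl-> : lam %= 1 by rewrite -size_poly_eq1 lam1.
exact: dvd1p.
Qed.

End Gauss.

(** * The algebra generated by two polynomials *)

(** Evaluation of a bivariate polynomial [rho(X, Y)] at [X = a], [Y = b], where
[Y] is the outer variable; the image is [K[a, b]].  Packaging the ring morphism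
in the definition lets polynomials over the source be mapped to [K[a, b]]. *)
Definition pair_eval (K : fieldType) (a b : {poly K}) :
    {rmorphism {poly {poly K}} -> {poly K}} :=
  (horner_eval b \o map_poly (comp_poly a))%FUN.

Section PairEval.
Variable K : fieldType.
Implicit Types (a b : {poly K}) (rho sigma : {poly {poly K}}).

Lemma pair_evalE a b n rho : (size rho <= n)%N ->
  pair_eval a b rho = \sum_(v < n) (rho`_v \Po a) * b ^+ v.
Proof.
move=> szr; rewrite /pair_eval /= /horner_eval.
rewrite (@horner_coef_wide _ n) ?(leq_trans (size_poly _ _)) //.
by apply: eq_bigr => v _; rewrite coef_map.
Qed.

Lemma pair_evalC a b p : pair_eval a b p%:P = p \Po a.
Proof. by rewrite /pair_eval /= map_polyC /= /horner_eval hornerC. Qed.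

Lemma pair_evalX a b : pair_eval a b 'X = b.
Proof. by rewrite /pair_eval /= map_polyX /horner_eval hornerX. Qed.

Lemma pair_evalB a b rho sigma :
  pair_eval a b (rho - sigma) = pair_eval a b rho - pair_eval a b sigma.
Proof. exact: (rmorphB (pair_eval a b)). Qed.

Lemma pair_evalD a b rho sigma :
  pair_eval a b (rho + sigma) = pair_eval a b rho + pair_eval a b sigma.
Proof. exact: (rmorphD (pair_eval a b)). Qed.

Lemma pair_evalM a b rho sigma :
  pair_eval a b (rho * sigma) = pair_eval a b rho * pair_eval a b sigma.
Proof. exact: (rmorphM (pair_eval a b)). Qed.

Lemma pair_eval_polyC a b p : pair_eval a b (map_poly polyC p) = p \Po b.
Proof.
rewrite /pair_eval /= /horner_eval.
have -> // : map_poly (comp_poly a) (map_poly polyC p) = map_poly polyC p.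
by apply/polyP=> v; rewrite !coef_map /= comp_polyC.
Qed.

Lemma pair_evalN rho : exists rho', forall c d,
  pair_eval c d rho' = pair_eval (- c) (- d) rho.
Proof.
pose rho' := \poly_(v < size rho) ((- 1) ^+ v *: (rho`_v \Po (- 'X))).
exists rho' => c d; rewrite (@pair_evalE _ _ (size rho)) ?size_poly //.
rewrite (@pair_evalE _ _ (size rho)) //; apply: eq_bigr => v _.
rewrite coef_poly ltn_ord comp_polyZ -comp_polyA -scalerAl.
rewrite raddfN /= comp_polyX scalerAr; congr (_ * _).
rewrite [in RHS]exprNn -[in LHS]signr_odd scaler_sign.
by rewrite -[in RHS]signr_odd mulr_sign.
Qed.

Lemma pair_eval_comp a b c rho :
  pair_eval a b rho \Po c = pair_eval (a \Po c) (b \Po c) rho.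
Proof.
rewrite !(@pair_evalE _ _ (size rho)) // rmorph_sum; apply: eq_bigr => v _.
by rewrite rmorphM rmorphXn /= comp_polyA.
Qed.

End PairEval.

(* Otherwise simplification would unfold the packaged morphism. *)
Local Opaque pair_eval.

(** * Lüroth's theorem for a pair with coprime outer degrees *)

Section CoprimeOuterDegrees.
Variables (K : fieldType) (alpha a beta b : {poly K}) (i j k : nat).
Hypotheses (relation : alpha \Po a = beta \Po b) (coij : coprime i j).
Hypotheses (i_gt0 : (0 < i)%N) (j_gt0 : (0 < j)%N) (k_gt0 : (0 < k)%N).
Hypotheses (deg_a : deg a = (j * k)%N).
Hypotheses (deg_beta : deg beta = j) (deg_b : deg b = (i * k)%N).
Local Notation ev := (pair_eval a b).
Implicit Types (rho : {poly {poly K}}) (p : {poly K}).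

Let a_neq0 : a != 0.
Proof. by apply: deg_gt0_neq0; rewrite deg_a muln_gt0 j_gt0. Qed.

Let b_neq0 : b != 0.
Proof. by apply: deg_gt0_neq0; rewrite deg_b muln_gt0 i_gt0. Qed.

Let size_a : (1 < size a)%N.
Proof. by rewrite -deg_gt0 deg_a muln_gt0 j_gt0. Qed.

(** The terms [rho_v(a) b^v] have degrees [(j deg rho_v + i v) k].  For [v < j]
these are distinct, because [i] is invertible modulo [j]. *)
Lemma pair_eval_normal rho : rho != 0 -> (size rho <= j)%N ->
  ev rho != 0 /\ (k %| deg (ev rho))%N.
Proof.
move=> rho0 szr; rewrite (pair_evalE _ _ szr).
pose f (v : 'I_j) := (rho`_v \Po a) * b ^+ v.
have f_neq0 v : f v != 0 -> rho`_v != 0.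
  by apply: contraNneq => rv; rewrite /f rv comp_poly0 mul0r.
have deg_f v : f v != 0 -> deg (f v) = ((deg (rho`_v) * j + i * v) * k)%N.
  move=> /f_neq0 rv; rewrite degM ?comp_poly_eq0 ?expf_neq0 //.
  by rewrite deg_comp degX deg_a deg_b; ring.
have ex_f : exists v, f v != 0.
  have szr0 : ((size rho).-1 < j)%N by rewrite prednK // size_poly_gt0.
  exists (Ordinal szr0).
  by rewrite mulf_neq0 ?expf_neq0 // comp_poly_eq0 //= -lead_coefE lead_coef_eq0.
have [[v [w [vw fv fw]]] | [v fv szf]] := deg_sum_tie ex_f.
  rewrite !deg_f // => /eqP; rewrite eqn_pmul2r // => /eqP dvw.
  have eqm : (i * v == i * w %[mod j])%N.
    rewrite -(modnMDl (deg rho`_v) (i * v)) dvw.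
    by rewrite (modnMDl (deg rho`_w) (i * w)).
  case/eqP: vw; apply: val_inj => /=; move: eqm.
  have coji : coprime j i by rewrite coprime_sym.
  clear dvw; wlog vw : v w fv fw / (v <= w)%N => [wl|].
    have [vw|/ltnW wv] := leqP v w; first exact: wl.
    by rewrite eq_sym => /(wl w v fw fv wv)/esym.
  rewrite eq_sym eqn_mod_dvd ?leq_mul2l ?vw ?orbT // -mulnBr Gauss_dvdr //.
  case: (posnP (w - v)) => [wv _|wv /(dvdn_leq wv)]; first by lia.
  by have := ltn_ord w; lia.
rewrite -size_poly_gt0 szf size_poly_gt0 fv; split=> //.
by rewrite /deg szf -/(deg (f v)) deg_f // dvdn_mull.
Qed.

(** Dividing by [beta(Y) - alpha(X)], which vanishes at [(a, b)] and has a unit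
as leading coefficient in [Y], reduces to degree less than [j] in [Y]. *)
Lemma pair_eval_dvd rho : (k %| deg (ev rho))%N.
Proof.
pose rel := map_poly polyC beta - alpha%:P : {poly {poly K}}.
have szb : size (map_poly polyC beta) = j.+1.
  by rewrite size_map_polyC size_deg ?deg_beta // deg_gt0_neq0 ?deg_beta.
have sza : (size (- alpha%:P : {poly {poly K}}) < size (map_poly polyC beta))%N.
  by rewrite size_polyN szb (leq_ltn_trans (size_polyC_leq1 _)).
have szrel : size rel = j.+1 by rewrite /rel size_polyDl.
have lead_rel : lead_coef rel \is a GRing.unit.
  rewrite /rel lead_coefDl // lead_coef_map_inj //; last exact: polyC_inj.
  by rewrite poly_unitE size_polyC coefC eqxx unitfE lead_coef_eq0
    deg_gt0_neq0 ?deg_beta.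
have ev_rel : ev rel = 0.
  by rewrite /rel pair_evalB pair_eval_polyC pair_evalC relation subrr.
rewrite (Pdiv.IdomainUnit.divp_eq lead_rel rho) pair_evalD pair_evalM ev_rel.
rewrite mulr0 add0r; have [-> | r0] := eqVneq (rho %% rel) 0.
  by rewrite (rmorph0 ev) /deg size_poly0 dvdn0.
apply: (proj2 (pair_eval_normal r0 _)).
by rewrite -ltnS -szrel ltn_modp -size_poly_eq0 szrel.
Qed.

(** The polynomial [P] has coefficients in [K[a, b]], of degrees divisible by
[k], so two terms [P_s X^s] with [s <= k] can have equal degrees only for
[s = 0] and [s = k].  A vanishing sum requires such a tie. *)
Lemma dependence_tie (Q : {poly {poly {poly K}}}) :
    let P := map_poly ev Q in
    P != 0 -> (size P <= k.+1)%N -> P.['X] = 0 ->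
  [/\ size P = k.+1, P`_0 != 0 & deg P`_0 = (deg P`_k + k)%N].
Proof.
move=> P P0 szP PX; pose f (s : 'I_k.+1) := P`_s * 'X^s.
have Pdvd s : (k %| deg P`_s)%N by rewrite coef_map pair_eval_dvd.
have deg_f s : f s != 0 -> deg (f s) = (deg (P`_s) + s)%N.
  by rewrite mulf_eq0 negb_or => /andP[Ps Xs]; rewrite degM // degXn.
have sum_f : \sum_s f s = 0.
  by rewrite -[RHS]PX (horner_coef_wide _ szP).
have ex_f : exists s, f s != 0.
  have szP0 : ((size P).-1 < k.+1)%N by rewrite prednK // size_poly_gt0.
  exists (Ordinal szP0); rewrite mulf_neq0 ?(monic_neq0 (monicXn _ _)) //.
  by move: P0; rewrite -lead_coef_eq0.
have [[s [t [st fs ft dst]]] | [s fs]] := deg_sum_tie ex_f; last first.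
  by rewrite sum_f size_poly0 => /esym/eqP; rewrite size_poly_eq0 (negPf fs).
wlog lt_st : s t st fs ft dst / (s < t)%N => [wl|].
  have := st; rewrite -val_eqE neq_ltn => /orP[]; first exact: wl.
  by apply: wl => //; rewrite eq_sym.
move: dst; rewrite !deg_f // => dst.
have dvd_st : (k %| t - s)%N.
  rewrite -(dvdn_addr _ (Pdvd t)).
  by rewrite (_ : _ + _ = deg P`_s)%N ?Pdvd //; lia.
have le_k : (k <= t - s)%N by apply: dvdn_leq dvd_st; rewrite subn_gt0.
have tk : (t <= k)%N by rewrite -ltnS ltn_ord.
have [s0 tE] : (s = 0 :> nat) /\ (t = k :> nat) by lia.
have coef_neq0 (r : 'I_k.+1) : f r != 0 -> P`_r != 0.
  by apply: contraNneq => r0; rewrite /f r0 mul0r.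
have := coef_neq0 _ ft; have := coef_neq0 _ fs; move: dst; rewrite s0 tE addn0.
move=> dst P_0 P_k; split=> //; apply/eqP; rewrite eqn_leq szP ltnNge.
by apply: contra P_k => /leq_sizeP->.
Qed.

(** With [u <= deg b], [v < j] and [s <= k], the products [a^u b^v X^s] outnumber
the coefficients available in their degrees, hence are linearly dependent.
Collecting the powers of [X] gives [P], and [P] is nonzero because a nonzero
polynomial of degree less than [j] in [Y] has a nonzero value at [(a, b)]. *)
Lemma exists_dependence : exists Q : {poly {poly {poly K}}},
  let P := map_poly ev Q in
  [/\ P != 0, (size Q <= k.+1)%N & P.['X] = 0].
Proof.
pose U := (deg b).+1.
pose I : finType := ('I_k.+1 * ('I_j * 'I_U))%type.
pose f (x : I) := a ^+ x.2.2 * b ^+ x.2.1 * 'X^(x.1).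
have sz_pow (p : {poly K}) n : p != 0 -> size (p ^+ n) = (deg p * n).+1.
  by move=> p0; rewrite size_deg ?expf_neq0 // degX.
pose n := (deg a * deg b + deg b * j.-1 + k.+1)%N.
have szf x : (size (f x) <= n)%N.
  case: x => [s [v u]]; rewrite /f /=.
  rewrite size_mul ?mulf_neq0 ?expf_neq0 ?polyX_eq0 // size_polyXn.
  rewrite size_mul ?expf_neq0 // (sz_pow _ _ a_neq0) (sz_pow _ _ b_neq0).
  have le_u : (deg a * u <= deg a * deg b)%N.
    by rewrite leq_mul2l orbC -ltnS ltn_ord.
  have le_v : (deg b * v <= deg b * j.-1)%N.
    by rewrite leq_mul2l orbC -ltnS prednK // ltn_ord.
  by have := ltn_ord s; rewrite /n; lia.
have lt_n : (n < #|I|)%N.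
  rewrite !card_prod !card_ord /n /U deg_a deg_b.
  by move: i_gt0 j_gt0 k_gt0; case: (j) => // j' _ _ _ /=; nia.
have [c [x0 cx0] sum_c] := poly_family_dependent szf lt_n.
have jE : j = j.-1.+1 by rewrite prednK.
(* The family [c], extended to natural indices to serve as coefficients. *)
pose c' (s v u : nat) : K :=
  c (inord s, (cast_ord (esym jE) (inord v), inord u)).
have c'E (s : 'I_k.+1) (v : 'I_j) (u : 'I_U) : c' s v u = c (s, (v, u)).
  rewrite /c' /= !inord_val; congr (c (_, (_, _))).
  by apply: val_inj; rewrite /= inordK // -jE ltn_ord.
pose rho s : {poly {poly K}} := \poly_(v < j) \poly_(u < U) c' s v u.
pose Q := \poly_(s < k.+1) rho s.
have szQ : (size Q <= k.+1)%N by apply: size_poly.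
exists Q => P; split=> //.
  pose s := x0.1; apply: contraNneq cx0 => P0.
  have : P`_s = 0 by rewrite P0 coef0.
  rewrite coef_map coef_poly ltn_ord /=.
  have [rho0 _ | rho0 ev0] := eqVneq (rho s) 0; last first.
    by have [] := pair_eval_normal rho0 (size_poly _ _); rewrite ev0 eqxx.
  have : (rho s)`_(x0.2.1)`_(x0.2.2) = 0 by rewrite rho0 !coef0.
  rewrite coef_poly ltn_ord coef_poly ltn_ord c'E => cx; apply/eqP.
  by rewrite -cx /s; case: (x0) => [? []].
rewrite (@horner_coef_wide _ k.+1) ?(leq_trans (size_poly _ _)) //.
have : \sum_s \sum_v \sum_u c (s, (v, u)) *: f (s, (v, u)) = 0.
  rewrite -[RHS]sum_c.
  under [LHS]eq_bigr => s _ do rewrite pair_bigA.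
  by rewrite pair_bigA; apply: eq_bigr => -[s [v u]].
apply: etrans.
apply: eq_bigr => s _; rewrite coef_map coef_poly ltn_ord /=.
rewrite (pair_evalE _ _ (size_poly _ _)) mulr_suml.
apply: eq_bigr => v _; rewrite coef_poly ltn_ord poly_def linear_sum /=.
rewrite !mulr_suml; apply: eq_bigr => u _.
by rewrite comp_polyZ comp_Xn_poly c'E -!scalerAl.
Qed.

(** The relation of degree [k] is, up to its leading coefficient, the minimal
polynomial of [x] over the fraction field of [K[a, b]], so it divides
[a(y) - a(x)] there.  The lemma of Gauss shows that its coefficients become
polynomials once its leading coefficient is divided out; the constant one is
[q]. *)
Lemma exists_deg_quotient : exists rho sigma q,
  [/\ ev rho != 0, ev sigma = q * ev rho & deg q = k].
Proof.
have [Q [P0 szQ PX]] := exists_dependence; set P := map_poly ev Q in P0 PX.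
have [|szP P_0 degP] := dependence_tie P0 _ PX.
  by apply: leq_trans (size_poly _ _) szQ.
have szQE : size Q = k.+1.
  by apply/eqP; rewrite eqn_leq szQ -szP size_poly.
have lead_P : lead_coef P = ev (lead_coef Q).
  by rewrite !lead_coefE szP szQE coef_map.
have lead_P0 : ev (lead_coef Q) != 0 by rewrite -lead_P lead_coef_eq0.
(* [A] is [a(y) - a(x)], and [A'] lifts it to coefficients in [K[X, Y]]. *)
pose A : {poly {poly K}} := map_poly polyC a - a%:P.
pose A' : {poly {poly {poly K}}} :=
  map_poly (polyC \o polyC) a - ('X : {poly K})%:P%:P.
have A'E : map_poly ev A' = A.
  rewrite rmorphB /= map_polyC /= pair_evalC comp_polyX; congr (_ - _).
  by apply/polyP=> s; rewrite !coef_map /= pair_evalC comp_polyC.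
have AX : A.['X] = 0.
  by rewrite hornerD hornerN hornerC -/(comp_poly 'X a) comp_polyXr subrr.
have sz_lift : size (map_poly polyC a : {poly {poly K}}) = size a.
  exact: size_map_polyC.
have lead_A : lead_coef A = (lead_coef a)%:P.
  rewrite lead_coefDl ?lead_coef_map_inj //; first exact: polyC_inj.
  by rewrite size_polyN sz_lift (leq_ltn_trans (size_polyC_leq1 _)).
have [N divA] : exists N, ev (lead_coef Q) ^+ N *: A =
    map_poly ev (A' %/ Q) * P + map_poly ev (A' %% Q).
  exists (scalp A' Q); have := Pdiv.Idomain.divp_eq A' Q.
  move/(congr1 (map_poly ev)); rewrite map_polyZ A'E /= rmorphXn => ->.
  by rewrite [LHS]rmorphD [X in X + _]rmorphM.
(* The remainder also vanishes at [y = x], and its degree in [y] is less than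
[k]. *)
have rem0 : map_poly ev (A' %% Q) = 0.
  apply/eqP; apply: contraT => R0.
  have szR : (size (A' %% Q)%R < k.+1)%N.
    by rewrite -szQE ltn_modp -size_poly_eq0 szQE.
  have [||szRk _ _] := dependence_tie R0.
  - by apply: leq_trans (size_poly _ _) (ltnW szR).
  - move/(congr1 (horner^~ 'X)): divA.
    by rewrite hornerZ AX mulr0 hornerD hornerM PX mulr0 add0r => <-.
  by move/eqP: szRk; rewrite ltn_eqF // (leq_ltn_trans (size_poly _ _) szR).
rewrite rem0 addr0 mulrC in divA.
have lead_dvd := lead_coef_dvd (expf_neq0 N lead_P0) _ divA.
have /dvdpP[q qE] : lead_coef P %| P`_0.
  by apply: lead_dvd; rewrite lead_A size_polyC lead_coef_eq0 a_neq0.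
exists (lead_coef Q), Q`_0, q; split=> //; first by rewrite -lead_P -qE coef_map.
have q0 : q != 0 by apply: contraNneq P_0 => q0; rewrite qE q0 mul0r.
move: degP; rewrite qE degM ?lead_coef_eq0 // lead_coefE szP /= addnC => /eqP.
by rewrite eqn_add2l => /eqP.
Qed.

(** The polynomials that lie in the fraction field of [K[a, b]]. *)
Definition pair_rational p := exists rho sigma,
  ev rho != 0 /\ ev sigma = p * ev rho.

Lemma pair_rational_dvd p : pair_rational p -> (k %| deg p)%N.
Proof.
move=> [rho [sigma [rho0 sE]]].
have [-> | p0] := eqVneq p 0; first by rewrite /deg size_poly0 dvdn0.
have := pair_eval_dvd sigma.
by rewrite sE degM // dvdn_addl ?pair_eval_dvd.
Qed.

Lemma pair_rationalB p q :
  pair_rational p -> pair_rational q -> pair_rational (p - q).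
Proof.
move=> [r1 [s1 [r1_0 E1]]] [r2 [s2 [r2_0 E2]]].
exists (r1 * r2), (s1 * r2 - s2 * r1).
by rewrite pair_evalB !pair_evalM E1 E2 mulf_neq0 //; split=> //; ring.
Qed.

Lemma pair_rationalM p q :
  pair_rational p -> pair_rational q -> pair_rational (p * q).
Proof.
move=> [r1 [s1 [r1_0 E1]]] [r2 [s2 [r2_0 E2]]].
exists (r1 * r2), (s1 * s2).
by rewrite !pair_evalM E1 E2 mulf_neq0 //; split=> //; ring.
Qed.

Lemma pair_rational_eval rho : pair_rational (ev rho).
Proof. by exists 1, rho; rewrite (rmorph1 ev) oner_neq0 mulr1. Qed.

Lemma pair_rational_exp p n : pair_rational p -> pair_rational (p ^+ n).
Proof.
move=> Tp; elim: n => [|n IHn]; last by rewrite exprS; apply: pair_rationalM.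
by rewrite expr0 -(rmorph1 ev); apply: pair_rational_eval.
Qed.

Lemma pair_rationalZ (x : K) p : pair_rational p -> pair_rational (x *: p).
Proof.
rewrite -mul_polyC; apply: pair_rationalM.
by rewrite -[x%:P](comp_polyC _ a) -(pair_evalC a b); apply: pair_rational_eval.
Qed.

Hypothesis two : 2%:R != 0 :> K.
Hypotheses (odd_a : a \in @odd_polynomial K) (odd_b : b \in @odd_polynomial K).

Lemma pair_rational_reflect p : pair_rational p -> pair_rational (p \Po (- 'X)).
Proof.
have reflect rho : exists rho', ev rho' = ev rho \Po (- 'X).
  have [rho' rE] := pair_evalN rho; exists rho'.
  by rewrite rE pair_eval_comp !odd_polynomialN_comp.
move=> [rho [sigma [rho0 sE]]].
have [[r' rE] [s' s'E]] := (reflect rho, reflect sigma).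
exists r', s'; rewrite rE s'E sE comp_polyM; split=> //.
by rewrite comp_poly_eq0 // size_polyN size_polyX.
Qed.

(** As [k] is odd, [q(x)] and [-q(-x)] have the same leading term, so
antisymmetrizing [q] keeps its degree. *)
Lemma odd_right_factor : exists a1 b1 c,
  [/\ a1 \in @odd_polynomial K, b1 \in @odd_polynomial K,
      c \in @odd_polynomial K & [/\ a = a1 \Po c, b = b1 \Po c & deg c = k]].
Proof.
have [rho [sigma [q [rho0 sE dq]]]] := exists_deg_quotient.
have Tq : pair_rational q by exists rho, sigma.
have ok : odd k by have := odd_deg odd_a a_neq0; rewrite deg_a oddM => /andP[].
pose c := q - (q \Po (- 'X)).
have Tc : pair_rational c := pair_rationalB Tq (pair_rational_reflect Tq).
have oc : c \in @odd_polynomial K.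
  rewrite odd_polynomial_reflect // comp_polyB -comp_polyA raddfN /=.
  by rewrite comp_polyX opprK comp_polyXr opprB.
have q0 : q != 0 by apply: deg_gt0_neq0; rewrite dq.
have dNX : deg (- 'X : {poly K}) = 1%N by rewrite /deg size_polyN size_polyX.
have dqN : deg (q \Po (- 'X)) = k by rewrite deg_comp dNX muln1.
have c_k : c`_k = 2%:R * lead_coef q.
  rewrite coefB -{2}dqN -{1}dq -!lead_coefE lead_coef_comp -?deg_gt0 ?dNX //.
  rewrite -/(deg q) dq lead_coefN lead_coefX -signr_odd ok expr1 mulrN1 opprK.
  by rewrite mulr_natl mulr2n.
have ck0 : c`_k != 0 by rewrite c_k mulf_neq0 // lead_coef_eq0.
have szc : (size c <= k.+1)%N.
  apply: leq_trans (size_polyD _ _) _; rewrite size_polyN geq_max.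
  by rewrite -{1}dq -dqN /deg !leqSpred.
have dc : deg c = k.
  suff szcE : size c = k.+1 by rewrite /deg szcE.
  apply/eqP; rewrite eqn_leq szc ltnNge.
  by apply: contra ck0 => /leq_sizeP->.
have c_gt0 : (0 < deg c)%N by rewrite dc.
have factor p : p \in @odd_polynomial K -> pair_rational p ->
    exists2 p1, p1 \in @odd_polynomial K & p = p1 \Po c.
  apply: (odd_descent oc c_gt0) => [r|r x m Tr].
    by rewrite dc; apply: pair_rational_dvd.
  by apply: pair_rationalB => //; apply/pair_rationalZ/pair_rational_exp.
have [|a1 oa1 aE] := factor a odd_a.
  by rewrite -[a](comp_polyX) -(pair_evalC a b); apply: pair_rational_eval.
have [|b1 ob1 bE] := factor b odd_b.
  by rewrite -(pair_evalX a b); apply: pair_rational_eval.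
by exists a1, b1, c.
Qed.

End CoprimeOuterDegrees.

(** * The reduction monoid of odd polynomials *)

Lemma oddPoly_mulE (K : fieldType) (p q : oddPoly K) :
  (p * q)%g = p \Po q :> {poly K}.
Proof. by []. Qed.

Lemma is_unit_deg1 (K : fieldType) (a : oddPoly K) : is_unit a <-> deg a = 1%N.
Proof.
split=> [[b [ab _]]|da].
  have : (deg a * deg b = 1)%N.
    have := congr1 (fun p : oddPoly K => deg p) ab.
    by rewrite oddPoly_mulE deg_comp => ->; rewrite /deg size_polyX.
  by move/eqP; rewrite muln_eq1 => /andP[/eqP].
pose x := lead_coef a.
have a0 : (a : {poly K}) != 0 by apply: deg_gt0_neq0; rewrite da.
have x0 : x != 0 by rewrite lead_coef_eq0.
have aE : oddPoly_val a = x *: 'X.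
  apply/polyP=> n; rewrite coefZ coefX /x lead_coefE -/(deg _) da.
  case: n => [|[|n]]; rewrite ?mulr0 ?mulr1 //.
    have /odd_polynomialP[f ->] := oddPoly_valP a.
    by rewrite coefMX.
  by rewrite nth_default // size_deg // da.
have oV : x^-1 *: 'X \in @odd_polynomial K.
  exact: odd_polynomialZ (odd_polynomialX K).
exists (OddPoly oV); split; apply: val_inj; rewrite /= aE.
  by rewrite comp_polyZ comp_polyX scalerA divff // scale1r.
by rewrite comp_polyZ comp_polyX scalerA mulVf // scale1r.
Qed.

Theorem theorem1p2 (K : fieldType) (charK : [pchar K]%R =i pred0) :
  @is_reduction_monoid (oddPoly K) (fun p q : oddPoly K => (p + q)%R)
    (fun p : oddPoly K => deg p).
Proof.
have two : 2%:R != 0 :> K := @natr_neq0 _ charK 2 isT.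
split.
- split; [exact: addrA | exact: addrC | exists 0, (fun p => - p)].
  by split; [exact: add0r | exact: addNr].
- by move=> a b c; apply: val_inj; rewrite /= comp_polyD.
- by move=> a b; rewrite oddPoly_mulE deg_comp.
- move=> a b; rewrite /deg /=.
  have := size_polyD (oddPoly_val a) (oddPoly_val b).
  by move: (size _) (size _) (size _) => x y z; lia.
- exact: is_unit_deg1.
- move=> a b c c_gt1 /(congr1 (@oddPoly_val K)) /= abc; apply: val_inj => /=.
  apply/eqP; rewrite -subr_eq0 -(@comp_poly_eq0 _ _ (oddPoly_val c)).
    by rewrite comp_polyB abc subrr.
  by rewrite -deg_gt0 ltnW.
- move=> a b a_gt1 b_gt1 [x [[u xu] [v xv] dx]].
  have [a_gt0 b_gt0] := (ltnW a_gt1, ltnW b_gt1).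
  have uv : oddPoly_val u \Po a = oddPoly_val v \Po b.
    by rewrite -!oddPoly_mulE -xu -xv.
  have u0 : oddPoly_val u != 0.
    apply/negP=> /eqP u0; case: dx.
    by rewrite xu oddPoly_mulE u0 comp_poly0 /deg size_poly0.
  have [al [be [oal obe alE dC]]] :=
    odd_common_composite charK (oddPoly_valP u) (oddPoly_valP v)
      a_gt0 b_gt0 u0 uv.
  pose C : oddPoly K := (OddPoly oal * a)%g.
  have CE : C = (OddPoly obe * b)%g by apply: val_inj.
  exists C; split=> // y; split; last first.
    move=> [w ->]; split; last by exists (w * OddPoly obe)%g; rewrite CE mulgA.
    by exists (w * OddPoly oal)%g; rewrite mulgA.
  move=> [[u' yu] [v' yv]].
  have [|w ow yE] := odd_common_composite_factor (oddPoly_valP C) _ a_gt0 b_gt0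
    alE (etrans (esym (congr1 (@oddPoly_val K) yu))
                (congr1 (@oddPoly_val K) yv)) dC.
    by have := oddPoly_valP y; rewrite yu.
  by exists (OddPoly ow); apply: val_inj; rewrite yu.
- move=> alpha a beta b i j k alE di da dj db ijk coij.
  have [/andP[i_gt0 j_gt0] k_gt0] : (0 < i)%N && (0 < j)%N /\ (0 < k)%N.
    by move: ijk; rewrite !muln_gt0 => /andP[].
  have rel : oddPoly_val alpha \Po a = oddPoly_val beta \Po b.
    by rewrite -!oddPoly_mulE alE.
  have [a1 [b1 [c [oa1 ob1 oc [aE bE dc]]]]] :=
    odd_right_factor rel coij i_gt0 j_gt0 k_gt0 da dj db two
      (oddPoly_valP a) (oddPoly_valP b).
  exists (OddPoly oa1), (OddPoly ob1), (OddPoly oc).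
  by split=> //; apply: val_inj.
Qed.
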